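(* Among the $240$ norm-one elements of $\mathbb{O}_{E_8}$, the equation $e*e=e$, i.e. $\tau(\bar e)\cdot\tau^2(\bar e)=e$, has exactly twelve solutions. They are the elements of $T_1\sqcup T_2\sqcup T_3\sqcup T_4$, where $$T_1=\{1,\ \tfrac12(-1-e_5+e_6+e_7),\ \tfrac12(-1+e_5-e_6-e_7)\},$$ $$T_2=\{-e_1,\ \tfrac12(e_1+e_3+e_5+e_6),\ \tfrac12(e_1-e_3-e_5-e_6)\},$$ $$T_3=\{-e_2,\ \tfrac12(e_2+e_3-e_5-e_7),\ \tfrac12(e_2-e_3+e_5+e_7)\},$$ $$T_4=\{e_4,\ \tfrac12(e_3-e_4-e_6+e_7),\ \tfrac12(-e_3-e_4+e_6-e_7)\}.$$ Moreover $|T_i|=3$ for every $i$, and $$\sum_{e\in T_i}e=0,\qquad \langle e,e'\rangle=-1\ \ (e\ne e'\in T_i),\qquad \langle e,f\rangle=0\ \ (e\in T_i,\ f\in T_j,\ i\ne j).$$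
   Context: Octonions. $\mathbb{O}$ is the real division algebra of octonions with unit $1$ and basis $1,\mathrm{i},\mathrm{j},\mathrm{k},\mathrm{l},\mathrm{il},\mathrm{jl},\mathrm{kl}$; each imaginary basis unit squares to $-1$, distinct imaginary basis units anticommute, and the remaining products are given by the oriented triples $(\mathrm{i},\mathrm{j},\mathrm{k})$, $(\mathrm{i},\mathrm{l},\mathrm{il})$, $(\mathrm{j},\mathrm{l},\mathrm{jl})$, $(\mathrm{k},\mathrm{l},\mathrm{kl})$, $(\mathrm{jl},\mathrm{i},\mathrm{kl})$, $(\mathrm{kl},\mathrm{j},\mathrm{il})$, $(\mathrm{il},\mathrm{k},\mathrm{jl})$, where $(x,y,z)$ means $xy=z$, $yz=x$, $zx=y$. The imaginary units are relabelled $(e_1,\dots,e_7)=(\mathrm{i},\mathrm{j},\mathrm{l},\mathrm{k},\mathrm{kl},\mathrm{jl},\mathrm{il})$. $\bar x$ is octonionic conjugation, $n(x)=x\bar x$ is the composition norm, and $\langle x,y\rangle=x\bar y+y\bar x=2\operatorname{Re}(x\bar y)$, so norm-one elements have squared length $2$. Lattice. $\mathbb{O}_{E_8}$ is the $\mathbb{Z}$-span of $1,\mathrm{i},\mathrm{j},\mathrm{k},\mathrm{h},\mathrm{i}\mathrm{h},\mathrm{j}\mathrm{h},\mathrm{k}\mathrm{h}$, where $\mathrm{h}=\tfrac12(\mathrm{i}+\mathrm{j}+\mathrm{k}+\mathrm{l})$ (the Coxeter--Dickson octonions); it has $240$ elements with $n=1$. Okubo product. $x*y=\tau(\bar x)\cdot\tau^2(\bar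 y)$, where $\tau$ is the $\mathbb{R}$-linear map (an octonion automorphism of order three preserving $\mathbb{O}_{E_8}$) with $\tau(1)=1$, $\tau(e_3)=e_3$, $\tau(e_1)=e_2$, $\tau(e_2)=-e_4$, $\tau(e_4)=-e_1$, $\tau(e_5)=-e_7$, $\tau(e_7)=e_6$, $\tau(e_6)=-e_5$. *)

(* Defs.v *)
From mathcomp Require Import all_boot all_order all_algebra finmap.
From mathcomp Require Import boolp classical_sets functions cardinality reals.
From mathcomp Require Import ring.
Set Implicit Arguments.
Unset Strict Implicit.
Unset Printing Implicit Defensive.
Import Order.TTheory GRing.Theory Num.Theory.
Local Open Scope ring_scope.

(* Coordinates in the basis e_0 = 1, (e_1, ..., e_7) = (i, j, l, k, kl, jl, il);
   beware that e_3 = l and e_4 = k. *)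
Notation octonion R := 'rV[R]_8 (only parsing).

(* (x, y, z) stands for xy = z, yz = x, zx = y. *)
Definition oriented_triples : seq (nat * nat * nat) :=
  let: (i, j, l, k, kl, jl, il) := (1, 2, 3, 4, 5, 6, 7)%N in
  [:: (i, j, k); (i, l, il); (j, l, jl); (k, l, kl);
      (jl, i, kl); (kl, j, il); (il, k, jl)].

Definition oriented (a b c : nat) : bool :=
  [|| (a, b, c) \in oriented_triples, (b, c, a) \in oriented_triples
    | (c, a, b) \in oriented_triples].

(* The coefficient of e_c in the product e_a e_b. *)
Definition ocoef (a b c : nat) : int :=
  if a == 0%N then Posz (b == c)
  else if b == 0%N then Posz (a == c)
  else if a == b then - Posz (c == 0%N)
  else Posz (oriented a b c) - Posz (oriented b a c).

Section Octonions.
Variable R : realType.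
Implicit Types x y : octonion R.

Definition eo (a : nat) : octonion R := \row_(c < 8) ((c == a :> nat)%:R).

Definition omul x y : octonion R :=
  \row_(c < 8) \sum_(a < 8) \sum_(b < 8) (ocoef a b c)%:~R * x 0 a * y 0 b.

Definition ore x : R := x 0 0.

Definition oconj x : octonion R :=
  \row_(c < 8) (if c == 0 :> nat then x 0 c else - x 0 c).

(* onorm and oip take values in R, identified with R 1; see onormE and oipE. *)
Definition onorm x : R := ore (omul x (oconj x)).

Definition oip x y : R := ore (omul x (oconj y) + omul y (oconj x)).

Definition h_oct : octonion R := 2^-1 *: (eo 1 + eo 2 + eo 4 + eo 3).

Definition coxeter_dickson_basis : 8.-tuple (octonion R) :=
  [tuple eo 0; eo 1; eo 2; eo 4;
         h_oct; omul (eo 1) h_oct; omul (eo 2) h_oct; omul (eo 4) h_oct].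

Definition OE8 : set (octonion R) := [set x | inIntSpan coxeter_dickson_basis x].

Definition OE8_norm1 : set (octonion R) := [set x | OE8 x /\ onorm x = 1].

Definition tau_images : seq (octonion R) :=
  [:: eo 0; eo 2; - eo 4; eo 3; - eo 1; - eo 7; - eo 5; eo 6].

Definition tau x : octonion R := \sum_(a < 8) x 0 a *: tau_images`_a.

Definition okubo x y : octonion R :=
  omul (tau (oconj x)) (tau (tau (oconj y))).

Definition T1 : {fset octonion R} :=
  [fset eo 0; 2^-1 *: (- eo 0 - eo 5 + eo 6 + eo 7);
              2^-1 *: (- eo 0 + eo 5 - eo 6 - eo 7)]%fset.

Definition T2 : {fset octonion R} :=
  [fset - eo 1; 2^-1 *: (eo 1 + eo 3 + eo 5 + eo 6);
                2^-1 *: (eo 1 - eo 3 - eo 5 - eo 6)]%fset.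

Definition T3 : {fset octonion R} :=
  [fset - eo 2; 2^-1 *: (eo 2 + eo 3 - eo 5 - eo 7);
                2^-1 *: (eo 2 - eo 3 + eo 5 + eo 7)]%fset.

Definition T4 : {fset octonion R} :=
  [fset eo 4; 2^-1 *: (eo 3 - eo 4 - eo 6 + eo 7);
              2^-1 *: (- eo 3 - eo 4 + eo 6 - eo 7)]%fset.

(* T i is T_{i+1}. *)
Definition T (i : 'I_4) : {fset octonion R} := tnth [tuple T1; T2; T3; T4] i.

Lemma omul_conj x y (c : 'I_8) : omul x (oconj y) 0 c =
  \sum_(a < 8) \sum_(b < 8)
    (ocoef a b c * (-1) ^+ (b != 0%N :> nat))%:~R * (x 0 a * y 0 b).
Proof.
rewrite mxE; apply: eq_bigr => a _; apply: eq_bigr => b _; rewrite mxE.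
by case: eqP => _; rewrite /= ?expr1 ?mulr1 ?mulrN1 ?rmorphN !mulrA ?mulrN ?mulNr.
Qed.

Lemma ocoef_conj (a b c : 'I_8) :
  ocoef a b c * (-1) ^+ (b != 0%N :> nat)
    + ocoef b a c * (-1) ^+ (a != 0%N :> nat)
  = Posz ((a == b :> nat) && (c == 0%N :> nat)).*2.
Proof.
apply/eqP; case: a b c => [a lt_a] [b lt_b] [c lt_c] /=.
suff /allP/(_ a)/[!mem_iota]/(_ lt_a)/allP/(_ b)/[!mem_iota]/(_ lt_b)/allP/(_ c)
     /[!mem_iota]/(_ lt_c) :
  all (fun a => all (fun b => all (fun c =>
     ocoef a b c * (-1) ^+ (b != 0%N) + ocoef b a c * (-1) ^+ (a != 0%N)
       == Posz ((a == b) && (c == 0%N)).*2)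
     (iota 0 8)) (iota 0 8)) (iota 0 8) by [].
by vm_compute.
Qed.

Lemma oipE x y : omul x (oconj y) + omul y (oconj x) = oip x y *: eo 0.
Proof.
apply/rowP => c; rewrite /oip /ore [RHS]mxE [X in _ * X]mxE.
have [->|c_neq0] := eqVneq c 0; first by rewrite mulr1.
have /negPf-> : c != 0%N :> nat by [].
rewrite mulr0 mxE !omul_conj [X in _ + X]exchange_big -big_split /=.
apply: big1 => a _; rewrite -big_split /=; apply: big1 => b _.
rewrite [y 0 b * _]mulrC -mulrDl -rmorphD /= ocoef_conj.
by have /negPf-> : c != 0%N :> nat by []; rewrite andbF mul0r.
Qed.

Lemma onormE x : omul x (oconj x) = onorm x *: eo 0.
Proof.
have := oipE x x; rewrite /oip /onorm /ore mxE -!mulr2n -scaler_nat => e2.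
apply: (@scalerI _ _ (2 : R)); first by rewrite pnatr_eq0.
by rewrite e2 scalerA mulr_natl.
Qed.

Lemma oip_re x y : oip x y = 2 * ore (omul x (oconj y)).
Proof.
rewrite /oip /ore mxE mulr_natl mulr2n; congr (_ + _).
rewrite !omul_conj exchange_big; apply: eq_bigr => a _; apply: eq_bigr => b _.
rewrite [y 0 b * _]mulrC; congr (_%:~R * _).
apply/eqP; case: a b => [a lt_a] [b lt_b] /=.
suff /allP/(_ a)/[!mem_iota]/(_ lt_a)/allP/(_ b)/[!mem_iota]/(_ lt_b) :
  all (fun a => all (fun b =>
     ocoef b a 0 * (-1) ^+ (a != 0%N) == ocoef a b 0 * (-1) ^+ (b != 0%N))
     (iota 0 8)) (iota 0 8) by [].
by vm_compute.
Qed.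

End Octonions.

Arguments eo {R}.
Arguments OE8 {R}.
Arguments OE8_norm1 {R}.
Arguments T {R}.

(* Main.v *)
Require Import Defs.
From mathcomp Require Import all_boot all_order all_algebra finmap.
From mathcomp Require Import boolp classical_sets functions cardinality reals.
From mathcomp Require Import ring zify.
Set Implicit Arguments.
Unset Strict Implicit.
Unset Printing Implicit Defensive.
Import Order.TTheory GRing.Theory Num.Theory.
Local Open Scope classical_set_scope.
Local Open Scope ring_scope.

(** The elements of the Coxeter-Dickson order are half-integral in the basis
e_0, ..., e_7, so one of them is (1/2) v for an integer vector v, and everything
in the theorem becomes a question about integer vectors.  In these doubled
coordinates the order is the image of Z^8 under a triangular integral map
([combZ], inverted on its image by [coordZ]), and n((1/2) v) is a quarter of the
sum of the squares of the entries of v, because the form <x, y> is twice the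
euclidean dot product ([oip_dot]).  Hence the norm-one elements are exactly the
integer vectors with sum of squares 4 that pass the lattice test: a finite list,
with 240 entries ([OE8_norm1_halves]).

The product and tau have integral structure constants, so e * e = e for
e = (1/2) v says that v, multiplied with itself by the integral Okubo product,
gives 2 v ([halves_okubo]).  Running this test over the 240 vectors leaves the
twelve vectors listed in the four triples ([idempotentsZE]).  The Gram matrix of
these twelve vectors, again a finite integral computation, gives every remaining
claim: dot products -2 within a triple and 0 between triples are the inner
products -1 and 0, and triples that are orthogonal to each other are disjoint
since no norm-one element is orthogonal to itself ([T_oip]). *)

(** * Integral model in doubled coordinates *)

(** A sum that [vm_compute] can evaluate, unlike the locked big operators. *)
Definition sum8 (F : nat -> int) : int :=
  foldr (fun a s => F a + s) 0 (iota 0 8).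

Definition omulZ (v w : seq int) : seq int :=
  mkseq (fun c => sum8 (fun a => sum8 (fun b => ocoef a b c * v`_a * w`_b))) 8.

Definition dotZ (v w : seq int) : int := sum8 (fun a => v`_a * w`_a).

Definition conjZ (v : seq int) : seq int :=
  mkseq (fun c => if c == 0%N then v`_c else - v`_c) 8.

Definition tauZ (v : seq int) : seq int :=
  [:: v`_0; - v`_4; v`_1; v`_3; - v`_2; - v`_6; v`_7; - v`_5].

(** Twice the coordinates of the lattice vector with coefficients [s] in the
basis 1, i, j, k, h, ih, jh, kh, for which 2h = i + j + k + l,
2ih = -1 - j + k + il, 2jh = -1 + i - k + jl and 2kh = -1 - i + j + kl.  The
entries follow the order 1, i, j, l, k, kl, jl, il of e_0, ..., e_7. *)
Definition combZ (s : seq int) : seq int :=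
  [:: s`_0 * 2 - s`_5 - s`_6 - s`_7;
      s`_1 * 2 + s`_4 + s`_6 - s`_7;
      s`_2 * 2 + s`_4 - s`_5 + s`_7;
      s`_4;
      s`_3 * 2 + s`_4 + s`_5 - s`_6;
      s`_7; s`_6; s`_5].

(** The coordinates along l, il, jl and kl occur in h, ih, jh and kh only, so
they give the last four coefficients; the first four then follow by a division
by two, which is exact precisely on lattice vectors. *)
Definition coordZ (v : seq int) : seq int :=
  [:: ((v`_0 + v`_7 + v`_6 + v`_5) %/ 2)%Z;
      ((v`_1 - v`_3 - v`_6 + v`_5) %/ 2)%Z;
      ((v`_2 - v`_3 + v`_7 - v`_5) %/ 2)%Z;
      ((v`_4 - v`_3 - v`_7 + v`_6) %/ 2)%Z;
      v`_3; v`_7; v`_6; v`_5].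

Definition small_ints (m : nat) : seq int :=
  [seq Posz i | i <- iota 0 m.+1] ++ [seq - Posz i | i <- iota 1 m].

(** A depth-first search in which [m] is the part of the sum still to be spent;
candidates up to [m] in absolute value suffice since |a| <= a^2. *)
Fixpoint sum_of_squares (n m : nat) : seq (seq int) :=
  if n is n'.+1 then
    [seq a :: v | a <- [seq a <- small_ints m | `|a|%N ^ 2 <= m]%N,
                  v <- sum_of_squares n' (m - `|a|%N ^ 2)]
  else if m is 0%N then [:: [::]] else [::].

Definition norm1Z : seq (seq int) :=
  [seq v <- sum_of_squares 8 4 | combZ (coordZ v) == v].

(** For e = (1/2) v the product e * e is a quarter of the integral product of v
with itself, hence the factor 2 on the right. *)
Definition idemZ (v : seq int) : bool :=
  omulZ (tauZ (conjZ v)) (tauZ (tauZ (conjZ v))) == [seq a * 2 | a <- v].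

Definition idempotentsZ : seq (seq int) := [seq v <- norm1Z | idemZ v].

Definition TZ : seq (seq (seq int)) :=
  [:: [:: [:: 2; 0; 0; 0; 0; 0; 0; 0]; [:: -1; 0; 0; 0; 0; -1; 1; 1];
          [:: -1; 0; 0; 0; 0; 1; -1; -1]];
      [:: [:: 0; -2; 0; 0; 0; 0; 0; 0]; [:: 0; 1; 0; 1; 0; 1; 1; 0];
          [:: 0; 1; 0; -1; 0; -1; -1; 0]];
      [:: [:: 0; 0; -2; 0; 0; 0; 0; 0]; [:: 0; 0; 1; 1; 0; -1; 0; -1];
          [:: 0; 0; 1; -1; 0; 1; 0; 1]];
      [:: [:: 0; 0; 0; 0; 2; 0; 0; 0]; [:: 0; 0; 0; 1; -1; 0; -1; 1];
          [:: 0; 0; 0; -1; -1; 0; 1; -1]]].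

(** * Transfer of the octonion operations *)

Lemma sum8E (F : nat -> int) : \sum_(a < 8) F a = sum8 F.
Proof. by rewrite -(big_mkord predT) unlock. Qed.

Section Halves.
Variable R : realType.
Implicit Types (v w s : seq int) (x y e : octonion R).

Definition halves v : octonion R := \row_(c < 8) ((v`_c)%:~R / 2).

Lemma halvesE v (c : 'I_8) : halves v 0 c = (v`_c)%:~R / 2.
Proof. by rewrite mxE. Qed.

Lemma halves_inj v w :
  size v = 8 -> size w = 8 -> halves v = halves w -> v = w.
Proof.
move=> sv sw /rowP vw; apply: (@eq_from_nth _ 0); rewrite sv// => c lt_c8.
have := vw (Ordinal lt_c8); rewrite !halvesE /= => /mulIf.
by rewrite invr_eq0 pnatr_eq0 => /(_ isT)/intr_inj.
Qed.

Lemma halves_omul v w : omul (halves v) (halves w) = 2^-1 *: halves (omulZ v w).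
Proof.
apply/rowP => c; rewrite !mxE nth_mkseq // -sum8E rmorph_sum /= mulrA.
rewrite mulr_sumr mulr_suml; apply: eq_bigr => a _.
rewrite -sum8E rmorph_sum /= mulr_sumr mulr_suml; apply: eq_bigr => b _.
by rewrite !mxE !rmorphM /=; field.
Qed.

Lemma halves_conj v : oconj (halves v) = halves (conjZ v).
Proof.
apply/rowP => c; rewrite !mxE nth_mkseq //.
by case: ifP => // _; rewrite rmorphN mulNr.
Qed.

Lemma halves_tau v : tau (halves v) = halves (tauZ v).
Proof.
apply/rowP => c; rewrite /tau !big_ord_recl big_ord0 !mxE.
by case: c; do 8?[case=> [|//=]]; move=> /= *; rewrite ?rmorphN /=; ring.
Qed.

(** The basis units are orthogonal of length two: the real part of e_a times the
conjugate of e_b is 1 if a = b and 0 otherwise. *)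
Lemma oip_dot x y : oip x y = 2 * \sum_(a < 8) x 0 a * y 0 a.
Proof.
rewrite oip_re /ore omul_conj; congr (_ * _); apply: eq_bigr => a _.
have ocoef0 (b : 'I_8) :
    ocoef a b 0 * (-1) ^+ (b != 0%N :> nat) = Posz (a == b :> nat).
  apply/eqP; case: a b => [a lt_a] [b lt_b] /=; move: a lt_a b lt_b.
  by do 8?[case=> [|//=]]; move=> // _; do 8?[case=> [|//=]].
rewrite (bigD1 a) //= ocoef0 eqxx mul1r big1 ?addr0 // => b /negPf ba.
by rewrite ocoef0 eq_sym -val_eqE /= in ba *; rewrite ba mul0r.
Qed.

Lemma halves_oip v w : oip (halves v) (halves w) = (dotZ v w)%:~R / 2.
Proof.
rewrite oip_dot -[dotZ _ _]sum8E rmorph_sum mulr_sumr mulr_suml.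
by apply: eq_bigr => a _; rewrite !mxE rmorphM /=; field.
Qed.

Lemma halves_onorm v : onorm (halves v) = (dotZ v v)%:~R / 4.
Proof.
have : oip (halves v) (halves v) = 2 * onorm (halves v) by rewrite oip_re.
rewrite halves_oip => e; apply: (@mulfI _ 2); first by rewrite pnatr_eq0.
by rewrite -e; field.
Qed.

Lemma halves_okubo v :
  size v = 8 -> okubo (halves v) (halves v) = halves v <-> idemZ v.
Proof.
move=> sv; rewrite /okubo !halves_conj !halves_tau halves_omul.
set w := omulZ _ _; have -> : idemZ v = (w == [seq a * 2 | a <- v]) by [].
have -> : halves v = 2^-1 *: halves [seq a * 2 | a <- v].
  by apply/rowP => c; rewrite !mxE (nth_map 0) ?sv// rmorphM /=; field.
split=> [/scalerI|/eqP-> //]; rewrite invr_eq0 pnatr_eq0 => /(_ isT) eq_w.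
by apply/eqP/halves_inj; rewrite ?size_mkseq ?size_map.
Qed.

(** * The lattice and its norm-one vectors *)

Lemma eoE a : (a < 8)%N -> eo a = halves (mkseq (fun c => Posz (c == a) * 2) 8).
Proof.
move=> lt_a8; apply/rowP => c; rewrite !mxE nth_mkseq // rmorphM /=.
by rewrite mulfK ?pnatr_eq0.
Qed.

Lemma h_octE : h_oct R = halves [:: 0; 1; 1; 1; 1; 0; 0; 0].
Proof.
apply/rowP => c; rewrite !mxE; case: c.
by do 8?[case=> [|//=]] => /= _; field.
Qed.

(** The entries of the left vector are those of e_a itself, not doubled, so that
the product stays in doubled coordinates. *)
Lemma eo_omul a v :
  omul (eo a) (halves v) = halves (omulZ (mkseq (fun c => Posz (c == a)) 8) v).
Proof.
apply/rowP => c; rewrite !mxE nth_mkseq // -sum8E rmorph_sum mulr_suml.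
apply: eq_bigr => b _; rewrite -sum8E rmorph_sum mulr_suml /=.
apply: eq_bigr => d _; rewrite nth_mkseq// !mxE !rmorphM /=; ring.
Qed.

Definition basisZ : seq (seq int) :=
 [:: [:: 2; 0; 0; 0; 0; 0; 0; 0]; [:: 0; 2; 0; 0; 0; 0; 0; 0];
     [:: 0; 0; 2; 0; 0; 0; 0; 0]; [:: 0; 0; 0; 0; 2; 0; 0; 0];
     [:: 0; 1; 1; 1; 1; 0; 0; 0]; [:: -1; 0; -1; 0; 1; 0; 0; 1];
     [:: -1; 1; 0; 0; -1; 0; 1; 0]; [:: -1; -1; 1; 0; 0; 1; 0; 0]].

Lemma basisE (k : 'I_8) :
  (coxeter_dickson_basis R)`_k = halves (nth [::] basisZ k).
Proof.
rewrite /coxeter_dickson_basis h_octE !eo_omul !eoE //.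
case: k; do 8?[case=> [|//=]] => lt_k8; congr halves; by vm_compute.
Qed.

Lemma OE8_halves x : OE8 x <-> exists s, x = halves (combZ s).
Proof.
have combE s : halves (combZ s) =
    \sum_(k < 8) (coxeter_dickson_basis R)`_k *~ s`_k.
  under eq_bigr do rewrite basisE -scaler_int.
  apply/rowP => c; rewrite !big_ord_recl big_ord0 !mxE.
  by case: c; do 8?[case=> [|//=]] => /= _;
    rewrite ?(rmorphD, rmorphB, rmorphM) /=; field.
split=> [[m ->]|[s ->]].
  exists (mkseq (fun k => m (inord k)) 8); rewrite combE.
  by apply: eq_bigr => k _; rewrite nth_mkseq // inord_val.
exists [ffun k : 'I_8 => s`_k]; rewrite combE.
by apply: eq_bigr => k _; rewrite ffunE.
Qed.

Lemma mem_small_ints m a : (`|a| <= m)%N -> a \in small_ints m.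
Proof.
rewrite mem_cat; case: a => n; rewrite ?NegzE ?abszN absz_nat => le_nm.
  by rewrite map_f // mem_iota.
by rewrite orbC (map_f (fun i => - Posz i)) // mem_iota.
Qed.

(** The enumeration misses no vector; that it contains nothing else is checked
by computation in the one case where it matters. *)
Lemma mem_sum_of_squares n m v :
  size v = n -> (\sum_(a <- v) `|a|%N ^ 2 = m)%N -> v \in sum_of_squares n m.
Proof.
elim: n m v => [|n IHn] m [|a v] // => [_|[sv]]; first by rewrite big_nil => <-.
rewrite big_cons => <-; set sq := (\sum_(b <- v) _)%N.
apply: (@allpairs_f_dep _ (fun=> _) _ (fun a v => a :: v)).
  rewrite mem_filter leq_addr mem_small_ints //.
  rewrite (leq_trans _ (leq_addr _ _)) // expnS expn1.
  by case: `|a|%N => // k; rewrite leq_pmulr.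
by apply: IHn => //; rewrite addKn.
Qed.

(** Makes the computable test [combZ (coordZ v) == v] a complete test for
membership in the lattice. *)
Lemma combZK s : combZ (coordZ (combZ s)) = combZ s.
Proof.
have half2 (a b : int) : a = b * 2 -> (a %/ 2)%Z = b by move->; rewrite mulzK.
suff -> : coordZ (combZ s) = mkseq (nth 0 s) 8 by [].
by congr [:: _; _; _; _; _; _; _; _]; apply: half2 => /=; lia.
Qed.

Lemma dotZ_sum_of_squares v :
  size v = 8%N -> dotZ v v = Posz (\sum_(a <- v) `|a| ^ 2)%N.
Proof.
move=> sv; rewrite -[LHS]sum8E [in RHS](big_nth 0) sv big_mkord.
rewrite -[Posz _]natz natr_sum; apply: eq_bigr => c _.
by rewrite natz -[LHS]expr2 -abszX abszE ger0_norm ?sqr_ge0.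
Qed.

Lemma OE8_norm1_halves x :
  OE8_norm1 x <-> x \in [seq halves v | v <- norm1Z].
Proof.
split=> [[/OE8_halves[s ->]]|/mapP[v]].
  rewrite halves_onorm dotZ_sum_of_squares // => norm1.
  apply/map_f; rewrite mem_filter combZK eqxx mem_sum_of_squares //.
  have n4 : (4%:R : R) != 0 by rewrite pnatr_eq0.
  by apply/eqP; rewrite -(eqr_nat R) -[eqbLHS](divfK n4) norm1 mul1r.
rewrite mem_filter => /andP[/eqP lat_v short_v] ->; split.
  by apply/OE8_halves; exists (coordZ v); rewrite lat_v.
have /allP/(_ v short_v)/eqP :
  all (fun v => dotZ v v == 4) (sum_of_squares 8 4) by vm_compute.
by rewrite halves_onorm => ->; rewrite divff ?pnatr_eq0.
Qed.

Lemma size_norm1Z v : v \in norm1Z -> size v = 8%N.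
Proof. by rewrite mem_filter => /andP[/eqP<-]. Qed.

Lemma uniq_norm1Z : uniq norm1Z.
Proof. by vm_compute. Qed.

(** * Idempotents and the four triples *)

Lemma uniq_halves (vs : seq (seq int)) :
  {in vs, forall v, size v = 8%N} -> uniq vs -> uniq [seq halves v | v <- vs].
Proof.
move=> s8 u; rewrite map_inj_in_uniq // => v w /s8 sv /s8 sw; exact: halves_inj.
Qed.

Lemma size_idempotentsZ v : v \in idempotentsZ -> size v = 8%N.
Proof. by rewrite mem_filter => /andP[_ /size_norm1Z]. Qed.

(** The equation e * e = e is solved here, by testing it on all 240 norm-one
elements. *)
Lemma idempotentsZE : perm_eq idempotentsZ (flatten TZ).
Proof. by vm_compute. Qed.

Lemma TZ_idempotentsZ (i : 'I_4) v : v \in nth [::] TZ i -> v \in idempotentsZ.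
Proof.
move=> vi; rewrite (perm_mem idempotentsZE); apply/flattenP.
by exists (nth [::] TZ i); rewrite // mem_nth.
Qed.

Lemma size_TZ (i : 'I_4) v : v \in nth [::] TZ i -> size v = 8%N.
Proof. by move/TZ_idempotentsZ/size_idempotentsZ. Qed.

(** Being a permutation, rather than having the same elements, also yields the
cardinality and the sum of a triple. *)
Lemma T_halves (i : 'I_4) :
  perm_eq (@T R i) [seq halves v | v <- nth [::] TZ i].
Proof.
apply: uniq_perm; first exact: fset_uniq.
  apply: uniq_halves => [v|]; first exact: size_TZ.
  by apply: (@allP _ uniq TZ); rewrite ?mem_nth //; vm_compute.
have T_elt x v : x = halves v -> forall e, (e == x) = (e == halves v) by move->.
move=> e; case: i => [[|[|[|[|//]]]] lt_i4];
  rewrite /T (tnth_nth fset0) /= !inE -?orbA;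
  congr [|| _, _ | _]; apply: T_elt; apply/rowP => c; rewrite !mxE;
  by case: c; do 8?[case=> [|//=]] => /= _; field.
Qed.

Lemma T_mem (i : 'I_4) e :
  reflect (exists2 v, v \in nth [::] TZ i & e = halves v) (e \in T i).
Proof. by rewrite (perm_mem (T_halves i)); exact: mapP. Qed.

Lemma card_uniq (s : seq (octonion R)) (A : set (octonion R)) :
  uniq s -> (forall x, A x <-> x \in s) -> (A #= `I_(size s))%card.
Proof.
move=> us As; have -> : A = [set` [fset x in s]%fset].
  by apply/seteqP; split=> x /=; rewrite inE => /As.
by apply/card_eq_fsetP; rewrite card_fseq undup_id.
Qed.

Lemma solutions_halves e :
  OE8_norm1 e /\ okubo e e = e <-> e \in [seq halves v | v <- idempotentsZ].
Proof.
split=> [[/OE8_norm1_halves/mapP[v v1 ->]]|/mapP[v]].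
  move/(halves_okubo (size_norm1Z v1)) => idem_v.
  by apply: map_f; rewrite mem_filter idem_v v1.
rewrite mem_filter => /andP[idem_v v1] ->; split.
  by apply/OE8_norm1_halves; rewrite map_f.
exact/(halves_okubo (size_norm1Z v1)).
Qed.

Lemma TZ_dot (i j : 'I_4) v w : v \in nth [::] TZ i -> w \in nth [::] TZ j ->
  dotZ v w = if i == j then if v == w then 4 else -2 else 0.
Proof.
move=> vi wj; have : all (fun i => all (fun j => all (fun v => all (fun w =>
    dotZ v w == if i == j then if v == w then 4 else -2 else 0)
    (nth [::] TZ j)) (nth [::] TZ i)) (iota 0 4)) (iota 0 4) by vm_compute.
by move/allP/(_ (i : nat))/[!mem_iota]/(_ (ltn_ord i))/allP/(_ (j : nat))
  /[!mem_iota]/(_ (ltn_ord j))/allP/(_ v vi)/allP/(_ w wj)/eqP.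
Qed.

(** Including the squared length 2 makes this settle disjointness as well: an
element common to two triples would be orthogonal to itself. *)
Lemma T_oip (i j : 'I_4) e f : e \in T i -> f \in T j ->
  oip e f = if i == j then if e == f then 2 else -1 else 0.
Proof.
move=> /T_mem[v vi ->] /T_mem[w wj ->]; rewrite halves_oip (TZ_dot vi wj).
case: ifP => _; last by rewrite mul0r.
have [->|vw] := eqVneq v w; first by rewrite eqxx; field.
case: eqP => [/halves_inj vw'|_]; last by field.
case/eqP: vw; apply: vw'; apply: size_TZ; [exact: vi | exact: wj].
Qed.

Lemma T_sum (i : 'I_4) : \sum_(e <- @T R i) e = 0.
Proof.
rewrite (perm_big _ (T_halves i)) big_map; apply/rowP => c.
rewrite summxE mxE; under eq_bigr do rewrite mxE.
rewrite -mulr_suml -rmorph_sum /=.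
suff -> : \sum_(v <- nth [::] TZ i) v`_c = 0 by rewrite mul0r.
case: i c => [i lt_i4] [c lt_c8] /=.
have : all (fun i => all (fun c =>
    foldr (fun v (d : int) => v`_c + d) 0 (nth [::] TZ i) == 0)
    (iota 0 8)) (iota 0 4) by vm_compute.
move/allP/(_ i)/[!mem_iota]/(_ lt_i4)/allP/(_ c)/[!mem_iota]/(_ lt_c8)/eqP.
move=> sum0.
by rewrite -[RHS]sum0 unlock.
Qed.

End Halves.

Theorem proposition2 (R : realType) :
  let solutions : set (octonion R) :=
    [set e | OE8_norm1 e /\ okubo e e = e] in
  (@OE8_norm1 R #= `I_240)%card /\
  (solutions #= `I_12)%card /\
  solutions = \bigcup_(i in [set: 'I_4]) [set` T i] /\
  (forall i j : 'I_4, i != j -> [disjoint @T R i & T j]%fset) /\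
  (forall i : 'I_4, #|` @T R i| = 3%N) /\
  (forall i : 'I_4, \sum_(e <- @T R i) e = 0) /\
  (forall (i : 'I_4) (e e' : octonion R),
     e \in T i -> e' \in T i -> e != e' -> oip e e' = -1) /\
  (forall (i j : 'I_4) (e f : octonion R),
     i != j -> e \in T i -> f \in T j -> oip e f = 0).
Proof.
move=> solutions.
do 7?split.
- have -> : 240%N = size [seq @halves R v | v <- norm1Z].
    by rewrite size_map; vm_compute.
  apply: card_uniq; last exact: OE8_norm1_halves.
  exact: uniq_halves size_norm1Z uniq_norm1Z.
- have -> : 12%N = size [seq @halves R v | v <- idempotentsZ].
    by rewrite size_map (perm_size idempotentsZE).
  apply: card_uniq; last exact: solutions_halves.
  exact: uniq_halves size_idempotentsZ (filter_uniq _ uniq_norm1Z).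
- apply/seteqP; split=> e => [/solutions_halves|[i _] /T_mem[v vi ->]];
    last first.
    by apply/solutions_halves/map_f/(TZ_idempotentsZ vi).
  case/mapP=> v; rewrite (perm_mem idempotentsZE) => /flattenP[vs].
  move=> /(nthP [::])[i lt_i4 <-] vi ->.
  exists (Ordinal (lt_i4 : (i < 4)%N)); first by [].
  by apply/T_mem; exists v; first exact: vi.
- move=> i j neq_ij; apply/fdisjointP => e ei; apply/negP => ej.
  have := T_oip ei ej; rewrite (negPf neq_ij) (T_oip ei ei) !eqxx.
  by move/eqP; rewrite pnatr_eq0.
- move=> i; rewrite (perm_size (T_halves R i)) size_map; apply/eqP.
  have /allP size3 : all (fun vs => size vs == 3%N) TZ by [].
  by apply: size3; apply: mem_nth; apply: ltn_ord.
- exact: T_sum.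
- by move=> i e f ei fi /negPf ef; rewrite (T_oip ei fi) eqxx ef.
- by move=> i j e f /negPf ij ei fj; rewrite (T_oip ei fj) ij.
Qed.
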